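(* Let $\Omega=\{0,1,\dots,9\}$. For each five-subset $A\subseteq\Omega$ let $\alpha_A$ be the binary voltage on $K(10,3)$ defined on edges $\{S,T\}$ by \[ \alpha_A(S,T)=1\iff \{|S\cap A|,|T\cap A|\}\in\bigl\{\{0,1\},\{1,3\}\bigr\}. \] The voltages $\alpha_A$, as $A$ ranges over the five-subsets of $\Omega$, represent exactly $126$ fixed-base gauge classes (in $H^1(M_3(10);\mathbb F_2)$). These classes form one nonzero $S_{10}$-orbit. The stabilizer in $S_{10}$ of each class has order $28{,}800$ and is isomorphic to $S_5\wr C_2$.
   Context: $K(10,3)$ has as vertices the $3$-subsets of $\Omega$, adjacent iff disjoint. A binary voltage is a function from the unoriented edges to $\mathbb F_2$. Two voltages are in the same fixed-base gauge class iff they differ by a coboundary $(\delta f)(\{S,T\})=f(S)+f(T)$ with $f:V(K(10,3))\to\mathbb F_2$. $M_3(10)$ is the clique complex of $K(10,3)$; voltages with zero sum on every triangle are its $1$-cocycles over $\mathbb F_2$, and $H^1(M_3(10);\mathbb F_2)$ is the space of cocycles modulo coboundaries. $S_{10}$ acts by $(g\alpha)(\{S,T\})=\alpha(\{g^{-1}S,g^{-1}T\})$, inducing an action on $H^1(M_3(10);\mathbb F_2)$. $S_5\wr C_2=(S_5\times S_5)\rtimes C_2$ with $C_2$ swapping the factors. *)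

(* Defs.v *)
From HB Require Import structures.
From mathcomp Require Import all_boot all_order all_algebra all_fingroup.

Set Implicit Arguments.
Unset Strict Implicit.
Unset Printing Implicit Defensive.

Import GRing.Theory.
Local Open Scope ring_scope.

Notation Omega := 'I_10.
Notation S10 := [set: {perm Omega}].

Definition vertex : finType := {S : {set Omega} | #|S| == 3}.

Definition kneser_adj : rel vertex := fun S T => [disjoint val S & val T].

Definition clique (K : {set vertex}) : bool :=
  [forall S in K, forall T in K, (S != T) ==> kneser_adj S T].

Definition edge : finType := {e : {set vertex} | clique e && (#|e| == 2)}.

Definition triangle : finType := {t : {set vertex} | clique t && (#|t| == 3)}.

(** [voltage] is the space of 1-cochains of M_3(10) over F_2.  It is also given
    its finite additive group structure, so that the quotient and action
    theories of finite groups apply: in that structure [1%g] is the zero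
    voltage and [( * )%g] is addition. *)

Definition voltage : Type := {ffun edge -> 'F_2}.
HB.instance Definition _ := GRing.Zmodule.on voltage.
HB.instance Definition _ := Finite.on voltage.
HB.instance Definition _ := [finGroupMixin of voltage for +%R].

Definition coboundary (f : {ffun vertex -> 'F_2}) : voltage :=
  [ffun e : edge => \sum_(S in val e) f S].

Lemma coboundary_pair f (e : edge) S T :
  val e = [set S; T] -> coboundary f e = f S + f T.
Proof.
move=> eST; rewrite ffunE eST big_setU1 ?big_set1 // inE.
apply/eqP=> ST; case/andP: (valP e) => _.
by rewrite eST ST setUid cards1.
Qed.

Definition coboundaries : {set voltage} :=
  [set coboundary f | f : {ffun vertex -> 'F_2}].

Definition cocycles : {set voltage} :=
  [set a : voltage |
    [forall t : triangle, \sum_(e : edge | val e \subset val t) a e == 0]].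

Lemma coboundaries_group_set : group_set coboundaries.
Proof.
apply/group_setP; split=> [|_ _ /imsetP[f _ ->] /imsetP[g _ ->]].
  apply/imsetP; exists 0 => //; apply/ffunP=> e; rewrite !ffunE big1 // => S _.
  by rewrite ffunE.
apply/imsetP; exists (f + g) => //; apply/ffunP=> e.
by rewrite !ffunE -big_split; apply: eq_bigr => S _; rewrite ffunE.
Qed.
Canonical coboundaries_group := Group coboundaries_group_set.

Lemma cocycles_group_set : group_set cocycles.
Proof.
apply/group_setP; split=> [|a b].
  by rewrite inE; apply/forallP=> t; rewrite big1 // => e _; rewrite ffunE.
rewrite !inE => /forallP Za /forallP Zb; apply/forallP=> t.
have -> : \sum_(e : edge | val e \subset val t) (a * b)%g e =
   \sum_(e : edge | val e \subset val t) a e +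
   \sum_(e : edge | val e \subset val t) b e.
  by rewrite -big_split; apply: eq_bigr => e _; rewrite ffunE.
by rewrite (eqP (Za t)) (eqP (Zb t)) addr0.
Qed.
Canonical cocycles_group := Group cocycles_group_set.

Lemma voltage_norm (A B : {set voltage}) : A \subset 'N(B)%g.
Proof.
apply/subsetP=> a _; rewrite inE; apply/subsetP=> _ /imsetP[b Bb ->].
suff -> : (b ^ a = b)%g by [].
apply/conjg_fixP/commgP; exact: (addrC b a).
Qed.

(** The fixed-base gauge class of [a] is [gauge_class a], a coset of the
    coboundaries; as a set it is [{a + coboundary f}]. *)
Definition gauge_class (a : voltage) : coset_of coboundaries :=
  coset coboundaries a.

Lemma gauge_classP (a b : voltage) :
  reflect (exists f, b = a + coboundary f) (gauge_class a == gauge_class b).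
Proof.
have N c : c \in 'N(coboundaries)%g by apply: (subsetP (voltage_norm setT _)).
rewrite eq_sym; apply: (iffP eqP) => [/(rcoset_kercosetP (N b) (N a)) | [f ->]].
  case/rcosetP=> _ /imsetP[f _ ->] ->; exists f; exact: addrC.
apply/(rcoset_kercosetP (N _) (N a))/rcosetP.
by exists (coboundary f); [apply: imset_f | apply: addrC].
Qed.

(** This is H^1(M_3(10); F_2), whose zero element is [1%g]. *)
Definition H1 : {set coset_of coboundaries} := (cocycles / coboundaries)%g.

(** Products of permutations compose left to right, [(g * h) x = h (g x)], so
    the usual left action is a right action for the library's group law. *)

Section VertexEdgeImage.
Variable g : {perm Omega}.

Lemma vertex_im_proof (S : vertex) : #|g @: val S| == 3.
Proof. by rewrite card_imset ?(valP S) //; apply: perm_inj. Qed.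

Definition vertex_im (S : vertex) : vertex := Sub (g @: val S) (vertex_im_proof S).

Lemma vertex_im_inj : injective vertex_im.
Proof.
move=> S T /(congr1 val) /=; move/(imset_inj (@perm_inj _ g)) => ST.
exact: val_inj.
Qed.

Lemma edge_im_proof (e : edge) :
  clique (vertex_im @: val e) && (#|vertex_im @: val e| == 2).
Proof.
case/andP: (valP e) => /forall_inP Ke ce.
rewrite card_imset ?ce ?andbT; last exact: vertex_im_inj.
apply/forall_inP=> _ /imsetP[S eS ->]; apply/forall_inP=> _ /imsetP[T eT ->].
rewrite (inj_eq vertex_im_inj); apply/implyP=> ST.
have /implyP/(_ ST) := forall_inP (Ke S eS) T eT.
by rewrite /kneser_adj /= imset_disjoint //; apply: perm_inj.
Qed.

Definition edge_im (e : edge) : edge := Sub (vertex_im @: val e) (edge_im_proof e).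

End VertexEdgeImage.

Lemma vertex_im1 S : vertex_im 1 S = S.
Proof.
by apply: val_inj; rewrite /= -[RHS]imset_id; apply: eq_imset => x; rewrite perm1.
Qed.

Lemma vertex_imM g h S : vertex_im (g * h)%g S = vertex_im h (vertex_im g S).
Proof.
by apply: val_inj; rewrite /= -imset_comp; apply: eq_imset => x; rewrite /= permM.
Qed.

Lemma edge_im1 e : edge_im 1 e = e.
Proof.
by apply: val_inj; rewrite /= -[RHS]imset_id; apply: eq_imset; apply: vertex_im1.
Qed.

Lemma edge_imM g h e : edge_im (g * h)%g e = edge_im h (edge_im g e).
Proof.
by apply: val_inj; rewrite /= -imset_comp; apply: eq_imset; apply: vertex_imM.
Qed.

Definition voltage_im (a : voltage) (g : {perm Omega}) : voltage :=
  [ffun e => a (edge_im g^-1 e)].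

Lemma voltage_im1 : voltage_im^~ 1%g =1 id.
Proof. by move=> a; apply/ffunP=> e; rewrite ffunE invg1 edge_im1. Qed.

Lemma voltage_imM a : act_morph voltage_im a.
Proof. by move=> g h; apply/ffunP=> e; rewrite !ffunE invMg edge_imM. Qed.

Canonical voltage_action := TotalAction voltage_im1 voltage_imM.

(** A quotient action is partial in the library; by [class_action_dom] and
    [class_actionE] it is total here and is computed on representatives. *)
Definition class_action := (voltage_action / coboundaries)%act.

Lemma coboundaries_stable g a :
  a \in coboundaries -> voltage_im a g \in coboundaries.
Proof.
case/imsetP=> f _ ->; apply/imsetP.
exists [ffun S => f (vertex_im g^-1 S)] => //.
apply/ffunP=> e; rewrite !ffunE /=.
rewrite big_imset /=; last by apply: in2W; apply: vertex_im_inj.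
by apply: eq_bigr => S _; rewrite ffunE.
Qed.

Lemma class_action_dom : qact_dom voltage_action coboundaries = S10.
Proof.
apply/setP=> g; rewrite [RHS]inE; apply/astabsP => C /=.
have im h D : D \in rcosets coboundaries 'N(coboundaries) ->
   voltage_im^~ h @: D \in rcosets coboundaries 'N(coboundaries).
  case/rcosetsP=> a _ ->.
  have -> : voltage_im^~ h @: (coboundaries :* a)%g
          = (coboundaries :* voltage_im a h)%g.
    have sub k b c : c \in (coboundaries :* b)%g ->
        voltage_im c k \in (coboundaries :* voltage_im b k)%g.
      case/rcosetP=> z Bz ->; apply/rcosetP; exists (voltage_im z k).
        exact: coboundaries_stable.
      by apply/ffunP=> e; rewrite !ffunE.
    apply/setP=> c; apply/imsetP/idP => [[b Bb ->]|Bc]; first exact: sub.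
    exists (voltage_im c h^-1); last by rewrite -[RHS]/(voltage_action _ h) actKVin ?inE.
    by move/(sub h^-1%g): Bc; rewrite -[voltage_im (voltage_im a h) _]/(voltage_action (voltage_action a h) _) actKin ?inE.
  by apply/rcosetsP; exists (voltage_im a h); rewrite // (subsetP (voltage_norm setT _)).
apply/idP/idP => [Cg|]; last exact: im.
by rewrite -(actK (voltage_action^*) g C); apply: im.
Qed.

Lemma class_actionE a g :
  class_action (gauge_class a) g = gauge_class (voltage_im a g).
Proof.
apply: qactE; first exact: (subsetP (voltage_norm setT _)).
by rewrite class_action_dom inE.
Qed.

(** [S] and [T] range over both orderings of the endpoints, so the pair of
    sizes is read as an unordered one. *)
Definition alpha (A : {set Omega}) : voltage :=
  [ffun e : edge =>
    [exists S, exists T, (val e == [set S; T]) &&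
      ((#|val S :&: A|, #|val T :&: A|) \in [:: (0, 1); (1, 3)]%N)]%:R].

Definition five_subset_classes : {set coset_of coboundaries} :=
  [set gauge_class (alpha A) | A : {set Omega} & #|A| == 5].

Definition S5xS5 : finGroupType := ({perm 'I_5} * {perm 'I_5})%type.

(** [C_2] is the additive group of integers modulo 2, with identity [0]. *)
Definition swap (u : S5xS5) (c : 'Z_2) : S5xS5 :=
  if c == 0 then u else (u.2, u.1).

Lemma swap1 : swap^~ 1%g =1 id.
Proof. by []. Qed.

Lemma swapM u : act_morph swap u.
Proof. by case: u => x y [[|[|//]] ?] [[|[|//]] ?]. Qed.

Canonical swap_action := TotalAction swap1 swapM.

Lemma swap_is_groupAction : is_groupAction [set: S5xS5] swap_action.
Proof.
move=> c _; rewrite inE; apply/andP; split; first by apply/subsetP=> u; rewrite inE.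
apply/morphicP=> u v _ _; rewrite !actpermE /= /swap.
by case: ifP.
Qed.
Canonical swap_groupAction := GroupAction swap_is_groupAction.

Definition S5_wr_C2 : finGroupType := sdprod_by swap_groupAction.

(* Main.v *)
Require Import Defs.
From HB Require Import structures.
From mathcomp Require Import all_boot all_order all_algebra all_fingroup.
From mathcomp Require Import ring.

Set Implicit Arguments.
Unset Strict Implicit.
Unset Printing Implicit Defensive.

Import GRing.Theory.
Local Open Scope ring_scope.

(** Whether [alpha A] is [1] on an edge depends only on how many points of [A]
    its endpoints contain, and this gives at once that [alpha A] is a cocycle
    ([alpha_cocycle]: three disjoint triples miss one point, so the three
    counts add up to 4 or 5) and that [A] and its complement give the same
    class ([gauge_class_compl]: the difference is the coboundary of the
    function that marks the triples contained in [A] or disjoint from it).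

    There are no other coincidences.  A coboundary has even sum around every
    closed walk, and a suitable 4-cycle of the Kneser graph has odd sum for
    [alpha A] and even sum for [alpha ((x y) A)], whenever [x] is in [A] and
    [y] is not ([tperm_class_neq]).  So no transposition that exchanges a point
    of [A] with a point of its complement fixes the class of [A].  If now [B]
    is neither [A] nor its complement, then [B] meets both in points [x] and
    [y], and [(x y)] fixes [B]; were the classes of [A] and [B] equal,
    [(x y)] would fix the class of [A] ([gauge_class_alpha_eq]).  The zero class
    is fixed by all of [S10], so it is not the class of [A] either.

    Hence the 252 five-subsets give 126 classes, permuted transitively because
    [S10] is transitive on five-subsets.  The stabilizer of one of them has
    order 10! / 126 = 2 * 5! * 5!.  Numbering [A] and its complement by ['I_5]
    makes the wreath product act faithfully on [Omega], and it preserves the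
    partition into [A] and its complement; so it embeds in the stabilizer, and
    it is all of it because the orders agree. *)

(** * Values of alpha on edges *)

(** The symmetric form of the condition on sizes that defines [alpha]. *)
Definition linked (m n : nat) : bool :=
  ((m, n) \in [:: (0, 1); (1, 3)]%N) || ((n, m) \in [:: (0, 1); (1, 3)]%N).

Definition link (A : {set Omega}) (S T : vertex) : bool :=
  linked #|val S :&: A| #|val T :&: A|.

Lemma eq_set2 (T : finType) (a b c d : T) :
  [set a; b] = [set c; d] -> (a = c /\ b = d) \/ (a = d /\ b = c).
Proof.
move=> eq2.
have /set2P[eq_a | eq_a]: a \in [set c; d] by rewrite -eq2 set21.
  subst a; have /set2P[eq_b | ?]: b \in [set c; d] by rewrite -eq2 set22.
    have := set22 c d; rewrite -eq2 eq_b => /set2P[] ->; auto.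
  by left.
subst a; have /set2P[? | eq_b]: b \in [set c; d] by rewrite -eq2 set22.
  by right.
have := set21 c d; rewrite -eq2 eq_b => /set2P[] ->; auto.
Qed.

Lemma alphaE A (e : edge) S T :
  val e = [set S; T] -> alpha A e = (link A S T)%:R.
Proof.
move=> eST; rewrite ffunE; congr (nat_of_bool _)%:R.
apply/existsP/orP => [[S' /existsP[T' /andP[/eqP]]] | link_ST].
  by rewrite eST => /eq_set2[[-> ->]|[-> ->]]; [left | right].
case: link_ST => in_L; [exists S; apply/existsP; exists T | ].
  by rewrite eST eqxx.
exists T; apply/existsP; exists S.
by rewrite eST setUC eqxx.
Qed.

Lemma kneser_adj_neq S T : kneser_adj S T -> S != T.
Proof.
apply: contraTneq => ->; rewrite /kneser_adj -setI_eq0 setIid -cards_eq0.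
by rewrite (eqP (valP T)).
Qed.

Lemma kneser_adjC S T : kneser_adj S T = kneser_adj T S.
Proof. exact: disjoint_sym. Qed.

Lemma adj_edge S T : kneser_adj S T -> exists e : edge, val e = [set S; T].
Proof.
move=> adj; have P : clique [set S; T] && (#|[set S; T]| == 2)%N.
  rewrite cards2 (kneser_adj_neq adj) andbT.
  apply/forall_inP=> _ /set2P[]->; apply/forall_inP=> _ /set2P[]->.
  - by rewrite eqxx.
  - by rewrite adj implybT.
  - by rewrite kneser_adjC adj implybT.
  - by rewrite eqxx.
by exists (Sub [set S; T] P : edge); rewrite SubK.
Qed.

Lemma edgeP (e : edge) : exists S T, kneser_adj S T /\ val e = [set S; T].
Proof.
have [/forall_inP ce /cards2P[S [T [neqST eST]]]] := andP (valP e).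
exists S, T; split=> //.
have Se : S \in val e by rewrite eST set21.
have Te : T \in val e by rewrite eST set22.
by have /forall_inP/(_ T Te)/implyP/(_ neqST) := ce S Se.
Qed.

Lemma gauge_class_link A B f :
    alpha B = alpha A + coboundary f -> forall S T, kneser_adj S T ->
  (link B S T)%:R = (link A S T)%:R + (f S + f T).
Proof.
move=> eqB S T /adj_edge[e eST].
by rewrite -(alphaE B eST) -(alphaE A eST) -(coboundary_pair f eST) eqB ffunE.
Qed.

(** * Detecting a gauge class by its sum around a 4-cycle *)

Lemma F2_2 : 2 = 0 :> 'F_2. Proof. exact/val_inj. Qed.

Lemma natr_addb (a b : bool) : (a (+) b)%:R = a%:R + b%:R :> 'F_2.
Proof. by case: a b => [] [] //; apply/val_inj. Qed.

Lemma natr_bool_inj : injective (fun b : bool => b%:R : 'F_2).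
Proof. by case=> [] [] // /(congr1 val). Qed.

Definition cycle4 A S T U W :=
  link A S T (+) link A T U (+) link A U W (+) link A W S.

(** Going around the cycle, a coboundary contributes each [f S] twice. *)
Lemma gauge_class_cycle4 A B S T U W :
    gauge_class (alpha A) = gauge_class (alpha B) ->
    kneser_adj S T -> kneser_adj T U -> kneser_adj U W -> kneser_adj W S ->
  cycle4 A S T U W = cycle4 B S T U W.
Proof.
move/eqP/gauge_classP=> [f /gauge_class_link linkB] ST TU UW WS.
apply: natr_bool_inj; rewrite /cycle4 !natr_addb !linkB //.
set s := (X in X = _); rewrite -[s]addr0 -[in LHS](mul0r (f S + f T + f U + f W)).
by rewrite -F2_2 /s; ring.
Qed.

(** * Coordinates adapted to a five-subset *)

Lemma start_enum (A : {set Omega}) n x : #|A| = n.+1 -> x \in A ->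
  exists k : 'I_n.+1 -> Omega,
    [/\ injective k, forall i, k i \in A & k ord0 = x].
Proof.
move=> cA Ax; pose s := x :: enum (A :\ x).
have sz : size s = n.+1 by rewrite /= -cardE; move: cA; rewrite (cardsD1 x A) Ax.
have us : uniq s by rewrite /= enum_uniq mem_enum !inE eqxx.
have lt_s (i : 'I_n.+1) : (i < size s)%N by rewrite sz.
exists (fun i => nth x s i); split=> // [i j /eqP|i].
  by rewrite nth_uniq // => /eqP/val_inj.
by have:= mem_nth x (lt_s i); rewrite inE mem_enum !inE => /predU1P[->|/andP[]].
Qed.

(** Coordinates on [Omega] relative to a five-subset: the boolean tells whether
    the point lies in the subset, and ['I_5] numbers the points on each side. *)
Definition point := (bool * 'I_5)%type.

Definition framed (h : point -> Omega) (A : {set Omega}) :=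
  bijective h /\ forall p, (h p \in A) = p.1.

Lemma card_compl5 (A : {set Omega}) : #|A| = 5%N -> #|~: A| = 5%N.
Proof. by move=> cA; have := cardsC A; rewrite cA card_ord => -[]. Qed.

(** The freedom to prescribe one point on each side lets a computation for one
    concrete pair of five-subsets stand for every transposed pair. *)
Lemma frame_at (A : {set Omega}) x y :
    #|A| = 5%N -> x \in A -> y \notin A ->
  exists h, [/\ framed h A, h (true, ord0) = x & h (false, ord0) = y].
Proof.
move=> cA Ax; rewrite -in_setC => Ay.
have [k [injk kA k0]] := start_enum cA Ax.
have [l [injl lA l0]] := start_enum (card_compl5 cA) Ay.
pose h (p : point) := if p.1 then k p.2 else l p.2.
have hA p : (h p \in A) = p.1.
  by case: p => [[] i]; rewrite /h /= ?kA //; have:= lA i; rewrite inE => /negPf.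
exists h; split=> //; split=> //.
apply: inj_card_bij; last by rewrite card_prod card_bool !card_ord.
move=> p q eq_h; have : p.1 = q.1 by rewrite -!hA eq_h.
case: p q eq_h => [[] i] [[] j] //; rewrite /h /=.
  by move/injk->.
by move/injl->.
Qed.

Lemma frame_exists (A : {set Omega}) : #|A| = 5%N -> exists h, framed h A.
Proof.
move=> cA; have /card_gt0P[x Ax] : (0 < #|A|)%N by rewrite cA.
have /card_gt0P[y] : (0 < #|~: A|)%N by rewrite (card_compl5 cA).
by rewrite inE => Ay; have [h []] := frame_at cA Ax Ay; exists h.
Qed.

(** * Crossing transpositions move the class *)

Lemma vertex_seq (s : seq Omega) : uniq s -> size s = 3%N ->
  exists S : vertex, val S = [set x in s].
Proof.
move=> us sz; have P : #|[set x in s]| == 3 by rewrite cardsE (card_uniqP us) sz.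
by exists (Sub [set x in s] P : vertex); rewrite SubK.
Qed.

Lemma card_seqI (A : {set Omega}) s : uniq s ->
  #|[set x in s] :&: A| = count (mem A) s.
Proof.
move=> us; rewrite -size_filter -(card_uniqP (filter_uniq _ us)).
by apply: eq_card => x; rewrite !inE mem_filter /= andbC.
Qed.

Lemma disjoint_seq (s t : seq Omega) :
  ~~ has (mem s) t -> [disjoint [set x in s] & [set x in t]].
Proof.
move/hasPn=> st; rewrite disjoint_sym; apply/pred0P=> x /=; rewrite !inE.
by apply/andP=> -[/st/negP].
Qed.

(** The 4-cycle has 0, 1, 1, 2 points of [A] on its successive vertices, hence
    sum 1 + 0 + 0 + 0.  Its first vertex contains [y] and no vertex contains
    [x], so relative to the transposed subset the sizes are 1, 1, 1, 2 and the
    sum is 0. *)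
Lemma tperm_class_neq (A : {set Omega}) x y :
    #|A| = 5%N -> x \in A -> y \notin A ->
  gauge_class (alpha A) <> gauge_class (alpha (tperm x y @: A)).
Proof.
move=> cA Ax Ay eq_cl; have [h [[/bij_inj inj_h hA] hx hy]] := frame_at cA Ax Ay.
(* In coordinates, the transposition exchanges the two points numbered 0. *)
have hB p : (h p \in tperm x y @: A) = if p.2 == ord0 then ~~ p.1 else p.1.
  rewrite -[h p](tpermK x y) mem_imset; last exact: perm_inj.
  case: p => b i /=; case: eqP => [->|/eqP i0].
    by case: b; rewrite ?hx ?hy ?tpermL ?tpermR ?(negPf Ay) ?Ax.
  have neq_h c : h (c, ord0) != h (b, i).
    by rewrite (inj_eq inj_h) xpair_eqE negb_and (eq_sym ord0) i0 orbT.
  by rewrite tpermD ?hA // -?hx -?hy neq_h.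
have vtx (s : seq point) : uniq s -> size s = 3%N ->
      exists S : vertex, val S = [set z in map h s].
  by move=> us sz; apply: vertex_seq; rewrite ?map_inj_uniq ?size_map.
pose o k := @Ordinal 5 k.
pose s1 : seq point := [:: (false, ord0); (false, o 1 isT); (false, o 2 isT)].
pose s2 : seq point := [:: (true, o 1 isT); (false, o 3 isT); (false, o 4 isT)].
pose s3 : seq point := [:: (true, o 2 isT); (false, o 1 isT); (false, o 2 isT)].
pose s4 : seq point := [:: (true, o 3 isT); (true, o 4 isT); (false, o 3 isT)].
have [S defS] := vtx s1 isT erefl; have [T defT] := vtx s2 isT erefl.
have [U defU] := vtx s3 isT erefl; have [W defW] := vtx s4 isT erefl.
have adj (X Y : vertex) (s t : seq point) :
   val X = [set z in map h s] -> val Y = [set z in map h t] ->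
   ~~ has (mem s) t -> kneser_adj X Y.
  move=> dX dY st; rewrite /kneser_adj dX dY; apply: disjoint_seq.
  rewrite has_map; apply: contra st; rewrite (eq_has (a2 := mem s)) // => p /=.
  exact: mem_map.
have := gauge_class_cycle4 eq_cl (adj _ _ _ _ defS defT isT)
  (adj _ _ _ _ defT defU isT) (adj _ _ _ _ defU defW isT) (adj _ _ _ _ defW defS isT).
have cnt (X : vertex) (s : seq point) B : uniq s -> val X = [set z in map h s] ->
    #|val X :&: B| = count (fun p => h p \in B) s.
  by move=> us ->; rewrite card_seqI ?map_inj_uniq // count_map.
rewrite /cycle4 /link !(cnt S s1) // !(cnt T s2) // !(cnt U s3) // !(cnt W s4) //.
by rewrite /s1 /s2 /s3 /s4 /= !hA !hB.
Qed.

(** * The relations between the classes *)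

Lemma voltage_im_alpha A g : voltage_im (alpha A) g = alpha (g @: A).
Proof.
apply/ffunP=> e; rewrite [LHS]ffunE; have [S [T [_ eST]]] := edgeP e.
rewrite (alphaE _ eST) (@alphaE _ _ (vertex_im g^-1 S) (vertex_im g^-1 T)).
  have inter (X : vertex) : #|val (vertex_im g^-1 X) :&: A| = #|val X :&: g @: A|.
    rewrite -(card_imset _ (@perm_inj _ g)) imsetI; last exact: in2W (@perm_inj _ g).
    congr #|pred_of_set (_ :&: _)|; rewrite -imset_comp -[RHS]imset_id.
    by apply: eq_imset => x /=; rewrite permKV.
  by rewrite /link !inter.
by rewrite /= eST imsetU1 imset_set1.
Qed.

Lemma class_action_alpha A g :
  class_action (gauge_class (alpha A)) g = gauge_class (alpha (g @: A)).
Proof. by rewrite class_actionE voltage_im_alpha. Qed.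

Lemma card_setIC (S : vertex) (A : {set Omega}) :
  #|val S :&: ~: A| = (3 - #|val S :&: A|)%N /\ (#|val S :&: A| < 4)%N.
Proof.
have c3 : #|val S| = 3%N := eqP (valP S).
have := cardsID A (val S); rewrite c3 setDE.
by move: #|_| #|_| => m n /= <-; rewrite addKn ltnS leq_addr.
Qed.

(** The edges on which the two voltages differ are those whose sizes are 01, 02,
    13 or 23, i.e. those with exactly one endpoint of size 0 or 3. *)
Lemma gauge_class_compl A : gauge_class (alpha (~: A)) = gauge_class (alpha A).
Proof.
apply/esym/eqP/gauge_classP.
exists [ffun S => (#|val S :&: A| \in [:: 0; 3]%N)%:R].
apply/ffunP=> e; have [S [T [_ eST]]] := edgeP e.
rewrite [RHS]ffunE (alphaE _ eST) (alphaE _ eST) (coboundary_pair _ eST) !ffunE.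
rewrite /link; have [-> ltS] := card_setIC S A; have [-> ltT] := card_setIC T A.
rewrite -!natr_addb; congr (nat_of_bool _)%:R.
by move: ltS ltT; case: #|_| => [|[|[|[|//]]]] _; case: #|_| => [|[|[|[|//]]]].
Qed.

Lemma triangleP (t : triangle) : exists S T U,
  [/\ kneser_adj S T, kneser_adj T U, kneser_adj S U & val t = [set S; T; U]].
Proof.
have [/forall_inP ct /eqP c3] := andP (valP t).
have: uniq (enum (val t)) by apply: enum_uniq.
have: size (enum (val t)) = 3%N by rewrite -cardE.
have: forall X, (X \in enum (val t)) = (X \in val t) by move=> X; rewrite mem_enum.
case: (enum _) => [|S [|T [|U [|//]]]] // mem_t _ /=.
rewrite !inE negb_or andbT => /andP[/andP[ST SU] TU].
have [St Tt Ut] : [/\ S \in val t, T \in val t & U \in val t].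
  by rewrite -!mem_t !inE !eqxx !orbT.
have adj X Y : X \in val t -> Y \in val t -> X != Y -> kneser_adj X Y.
  by move=> Xt Yt; have /forall_inP/(_ Y Yt)/implyP := ct X Xt.
exists S, T, U; split; last by apply/setP=> X; rewrite -mem_t !inE orbA.
- exact: (adj S T).
- exact: (adj T U).
exact: (adj S U).
Qed.

Lemma sum_triangle (t : triangle) S T U (eST eTU eSU : edge) (a : voltage) :
    val t = [set S; T; U] -> S != T -> T != U -> S != U ->
    val eST = [set S; T] -> val eTU = [set T; U] -> val eSU = [set S; U] ->
  \sum_(e : edge | val e \subset val t) a e = a eST + a eTU + a eSU.
Proof.
move=> def_t ST TU SU dST dTU dSU.
have Ut: U \notin [set S; T] by rewrite !inE negb_or ![U == _]eq_sym SU TU.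
have Tt: T \notin [set S; U] by rewrite !inE negb_or [T == S]eq_sym ST TU.
rewrite (bigD1 eST) /=; last by rewrite dST def_t subsetUl.
rewrite (bigD1 eTU) /=; last first.
  rewrite def_t dTU subUset !sub1set !inE !eqxx !orbT /=.
  by apply: contraNneq Ut => /(congr1 val); rewrite dST dTU => <-; rewrite !inE eqxx orbT.
rewrite (bigD1 eSU) /=; last first.
  rewrite def_t dSU subUset !sub1set !inE !eqxx !orbT /=; apply/andP; split.
    by apply: contraNneq Ut => /(congr1 val); rewrite dST dSU => <-; rewrite !inE eqxx orbT.
  by apply: contraNneq Tt => /(congr1 val); rewrite dTU dSU => ->; rewrite !inE eqxx.
rewrite big1 ?addr0 ?addrA // => e /andP[/andP[/andP[]]]; rewrite def_t.
have [X [Y [adj eXY]]] := edgeP e; have neq := kneser_adj_neq adj.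
rewrite -!val_eqE /= dST dTU dSU eXY subUset !sub1set !inE -!orbA.
case/andP=> /or3P[]/eqP eX /or3P[]/eqP eY; subst X Y;
  by rewrite ?eqxx // in neq *; rewrite 1?setUC ?eqxx // [[set _; _]]setUC eqxx.
Qed.

(** The vertices of a triangle cover all points but one, so the three sizes
    add up to 4 or 5; [bound], for [A] and for its complement, gives these two
    inequalities.  The sizes are then 013, 022, 112, 023, 113 or 122, and among
    the three pairs of sizes an even number is 01 or 13. *)
Lemma alpha_cocycle (A : {set Omega}) : #|A| = 5%N -> alpha A \in cocycles.
Proof.
move=> cA; rewrite inE; apply/forallP=> t.
have [S [T [U [ST TU SU def_t]]]] := triangleP t.
have [e1 d1] := adj_edge ST; have [e2 d2] := adj_edge TU.
have [e3 d3] := adj_edge SU.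
rewrite (sum_triangle _ def_t _ _ _ d1 d2 d3) ?kneser_adj_neq //.
rewrite (alphaE A d1) (alphaE A d2) (alphaE A d3) -!natr_addb.
have bound (B : {set Omega}) : #|B| = 5%N ->
    (#|val S :&: B| + #|val T :&: B| + #|val U :&: B| <= 5)%N.
  move=> cB; apply: leq_trans (_ : #|B| <= 5)%N; last by rewrite cB.
  have disjI (X Y : {set Omega}) :
     [disjoint X & Y] -> (#|X :&: B| + #|Y :&: B|)%N = #|(X :|: Y) :&: B|.
    rewrite -setI_eq0 => /eqP XY.
    by rewrite setIUl cardsU setIACA XY set0I cards0 subn0.
  rewrite !disjI ?subset_leq_card ?subsetIr //.
  by rewrite -setI_eq0 setIUl setU_eq0 !setI_eq0; apply/andP; split; [apply: SU | apply: TU].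
move: (bound _ cA) (bound _ (card_compl5 cA)); rewrite /link.
have [-> ltS] := card_setIC S A; have [-> ltT] := card_setIC T A.
have [-> ltU] := card_setIC U A; move: ltS ltT ltU.
by case: #|_| => [|[|[|[|//]]]] _; case: #|_| => [|[|[|[|//]]]] _;
  case: #|_| => [|[|[|[|//]]]].
Qed.

(** If [B] differs from both [A] and its complement, it contains some [x] in [A]
    and some [y] outside [A].  The transposition [(x y)] fixes [B] but moves the
    class of [A], so the two classes differ. *)
Lemma gauge_class_alpha_eq (A B : {set Omega}) : #|A| = 5%N -> #|B| = 5%N ->
  (gauge_class (alpha A) == gauge_class (alpha B)) = (B \in [set A; ~: A]).
Proof.
move=> cA cB; apply/eqP/idP => [eqAB | /set2P[]->]; last first.
- by rewrite gauge_class_compl.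
- by [].
apply: contraT => neqB; have cA' := card_compl5 cA.
have sub_neq (C : {set Omega}) : C \in [set A; ~: A] -> #|C| = 5%N -> ~~ (B \subset C).
  move=> AC cC; apply: contra neqB => BC.
  by have /eqP-> : B == C by rewrite eqEcard BC cB cC.
have /subsetPn[y By Ay] := sub_neq A (set21 _ _) cA.
have /subsetPn[x Bx] := sub_neq (~: A) (set22 _ _) cA'.
rewrite inE negbK => Ax; case: (tperm_class_neq cA Ax Ay).
rewrite -class_action_alpha eqAB class_action_alpha; congr (gauge_class (alpha _)).
apply/esym/eqP; rewrite eqEcard card_imset ?leqnn ?andbT; last exact: perm_inj.
by apply/subsetP=> _ /imsetP[z Bz ->]; case: tpermP.
Qed.

Lemma five_subset_trans (A B : {set Omega}) : #|A| = 5%N -> #|B| = 5%N ->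
  exists g : {perm Omega}, g @: A = B.
Proof.
move=> cA cB; have [h [[k hK kK] hA]] := frame_exists cA; have [l [bij_l lB]] := frame_exists cB.
have inj_lk : injective (l \o k).
  by apply: inj_comp; [apply: bij_inj | apply: can_inj kK].
exists (perm inj_lk); apply/eqP; rewrite eqEcard card_imset ?cA ?cB //; last exact: perm_inj.
rewrite andbT; apply/subsetP=> _ /imsetP[x Ax ->].
by rewrite permE /= lB -hA kK.
Qed.

(** The zero class is fixed by every permutation, whereas the class of [A] is
    moved by a transposition. *)
Lemma gauge_class_neq1 (A : {set Omega}) : #|A| = 5%N -> gauge_class (alpha A) <> 1%g.
Proof.
move=> cA cl1; have /card_gt0P[x Ax] : (0 < #|A|)%N by rewrite cA.
have /card_gt0P[y] : (0 < #|~: A|)%N by rewrite (card_compl5 cA).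
rewrite inE => Ay; apply: (tperm_class_neq cA Ax Ay).
rewrite -class_action_alpha cl1 -[1%g](morph1 (coset_morphism coboundaries)) /=.
rewrite -[coset _ _]/(gauge_class 1%g) class_actionE; congr gauge_class.
by apply/ffunP=> e; rewrite !ffunE.
Qed.

(** * Counting classes and the order of the stabilizers *)

Lemma card_five_subset_classes : #|five_subset_classes| = 126%N.
Proof.
pose D := [set A : {set Omega} | #|A| == 5%N].
have cD : #|D| = 252%N by rewrite card_draws card_ord.
suff : (#|five_subset_classes| * 2 = 126 * 2)%N.
  by move/eqP; rewrite eqn_pmul2r // => /eqP.
(* Each class is attained by exactly two of the 252 five-subsets. *)
rewrite -[RHS]cD -[RHS]sum1_card.
rewrite (partition_big_imset (fun A => gauge_class (alpha A))) /= -sum_nat_const.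
apply: eq_bigr => _ /imsetP[A DA ->]; have cA : #|A| = 5%N by apply/eqP; rewrite inE in DA.
have neqA : A != ~: A.
  apply/eqP=> eqA; have /card_gt0P[x Ax] : (0 < #|A|)%N by rewrite cA.
  by have := Ax; rewrite eqA inE Ax.
have c2 : #|[set A; ~: A]| = 2%N by rewrite cards2 neqA.
apply: etrans (esym c2) _; rewrite -sum1_card; apply: eq_bigl => B; rewrite [B \in D]inE [gauge_class _ == _]eq_sym.
apply/idP/andP => [AB | [/eqP cB]]; last by rewrite gauge_class_alpha_eq.
have cB : #|B| = 5%N by case/set2P: AB => ->; rewrite ?(card_compl5 cA).
by rewrite cB gauge_class_alpha_eq.
Qed.

Lemma orbit_five_subset_class (A : {set Omega}) : #|A| = 5%N ->
  orbit class_action S10 (gauge_class (alpha A)) = five_subset_classes.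
Proof.
move=> cA; apply/setP=> c; apply/imsetP/imsetP => [[g _ ->] | [B]].
  exists (g @: A); last by rewrite /= class_action_alpha.
  by rewrite inE card_imset ?cA //; apply: perm_inj.
rewrite inE => /eqP cB ->; have [g <-] := five_subset_trans cA cB.
by exists g; rewrite ?inE //= class_action_alpha.
Qed.

(** 10! stays symbolic: as a unary number it is too large to compute with. *)
Lemma fact10 : 10`! = (252 * (5`! * 5`!))%N.
Proof.
have C252 : 'C(10, 5) = 252%N by [].
have d5 : (10 - 5 = 5)%N by [].
by have := @bin_fact 10 5 isT; rewrite C252 d5 => ->.
Qed.

Lemma card_class_stab c : c \in five_subset_classes ->
  #|('C_S10[c | class_action])%g| = (5`! * 5`! * 2)%N.
Proof.
case/imsetP=> A; rewrite inE => /eqP cA ->.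
have dom : S10 \subset qact_dom voltage_action coboundaries by rewrite class_action_dom.
have := card_orbit_in_stab class_action (gauge_class (alpha A)) dom.
rewrite orbit_five_subset_class // card_five_subset_classes cardsT card_Sn.
rewrite fact10; move: (5`! * 5`!)%N #|_| => m n /eqP.
by rewrite (_ : 252 = 126 * 2)%N // -mulnA eqn_pmul2l // mulnC => /eqP.
Qed.

Lemma card_wreath : #|[set: S5_wr_C2]| = (5`! * 5`! * 2)%N.
Proof.
rewrite cardsT card_sub /=.
have := cardsX [set: 'Z_2] [set: S5xS5]; rewrite !cardsT card_prod !card_Sn card_ord.
by rewrite mulnC => <-; apply: eq_card => u; rewrite !inE.
Qed.

Lemma mem_class_stab c g :
  (g \in 'C_S10[c | class_action]%g) = (class_action c g == c).
Proof.
have dom : g \in qact_dom voltage_action coboundaries.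
  by rewrite class_action_dom inE.
by rewrite inE in_setT in_setI dom inE sub1set inE.
Qed.

(** * The wreath product acting on the ten points *)

(** The imprimitive action of the wreath product.  The group element [(c, u)] is
    the product of [c] by [u] in this order, so for a right action the sides
    are first exchanged by [c] and then permuted by [u]. *)
Definition wreath_act (p : point) (u : S5_wr_C2) : point :=
  let b := p.1 (+) ((val u).1 != 0) in
  (b, (if b then (val u).2.1 else (val u).2.2) p.2).

Lemma wreath_act1 : wreath_act^~ 1%g =1 id.
Proof. by case=> [[] i]; rewrite /wreath_act /= perm1. Qed.

Lemma Z2_mulg_neq0 (c d : 'Z_2) : ((c * d)%g != 0) = (c != 0) (+) (d != 0).
Proof. by case: c d => [[|[|//]] ?] [[|[|//]] ?]. Qed.

Lemma wreath_actM p : act_morph wreath_act p.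
Proof.
case: p => b i [[c [u1 u2]] ?] [[d [v1 v2]] ?]; rewrite /wreath_act /= /swap.
rewrite Z2_mulg_neq0.
by case: b; case: (c == 0); case: (d == 0); rewrite /= permM.
Qed.

Section FrameAction.
Variables (h : point -> Omega) (k : Omega -> point).
Hypotheses (hK : cancel h k) (kK : cancel k h).

Definition frame_act (x : Omega) (u : S5_wr_C2) : Omega := h (wreath_act (k x) u).

Lemma frame_act1 : frame_act^~ 1%g =1 id.
Proof. by move=> x; rewrite /frame_act wreath_act1 kK. Qed.

Lemma frame_actM x : act_morph frame_act x.
Proof. by move=> u v; rewrite /frame_act wreath_actM hK. Qed.

Definition frame_action := TotalAction frame_act1 frame_actM.

Lemma injm_frame_action : ('injm (actperm frame_action))%g.
Proof.
apply/subsetP=> u /morphpreP[_ /set1P u1].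
have fix_u p : wreath_act p u = p.
  have /(congr1 k) : frame_action (h p) u = h p.
    by rewrite -actpermE u1 perm1.
  by rewrite /= /frame_act !hK.
apply/set1P/val_inj; case: u fix_u {u1} => [[c [u1 u2]] ?] fix_u /=.
have c0 : c = 0.
  by have := congr1 fst (fix_u (true, ord0)); rewrite /=; case: eqP.
subst c; congr (_, (_, _)); apply/permP=> i; rewrite perm1.
  by have := congr1 snd (fix_u (true, i)).
by have := congr1 snd (fix_u (false, i)).
Qed.

(** An element of the wreath product either preserves or exchanges the two
    sides, and the class of [A] is also that of its complement. *)
Lemma frame_action_sub_stab (A : {set Omega}) : (forall p, (h p \in A) = p.1) ->
  (actperm frame_action @* setT)%g
    \subset 'C_S10[gauge_class (alpha A) | class_action]%g.
Proof.
move=> hA; apply/subsetP=> _ /morphimP[u _ _ ->]; rewrite mem_class_stab class_action_alpha /=.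
set g := actperm _ u.
have gA x : (g x \in A) = (x \in A) (+) ((val u).1 != 0).
  by rewrite /g actpermE /= /frame_act hA /= -[in RHS](kK x) hA.
suff [-> | ->] : g @: A = A \/ g @: A = ~: A.
- exact: eqxx.
- by rewrite gauge_class_compl eqxx.
have im_g (B : {set Omega}) : (forall x, (g x \in B) = (x \in A)) -> g @: A = B.
  move=> gB; apply/setP=> x; rewrite -[x](permKV g) gB mem_imset //.
  exact: perm_inj.
case: ((val u).1 != 0) gA => gA; [right | left]; apply: im_g => x.
  by rewrite inE gA addbT negbK.
by rewrite gA addbF.
Qed.

End FrameAction.

Theorem theorem7p5 :
  [/\ five_subset_classes \subset H1,
      #|five_subset_classes| = 126%N,
      1%g \notin five_subset_classes
        /\ [transitive S10, on five_subset_classes | class_action]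
    & forall c, c \in five_subset_classes ->
        #|('C_S10[c | class_action])%g| = 28800%N
        /\ ('C_S10[c | class_action])%g \isog [set: S5_wr_C2]].
Proof.
split.
- apply/subsetP=> _ /imsetP[A + ->]; rewrite inE => /eqP cA.
  apply: mem_quotient; exact: alpha_cocycle.
- exact: card_five_subset_classes.
- split.
    apply/imsetP=> -[A]; rewrite inE => /eqP cA /esym.
    exact: gauge_class_neq1.
  have /card_gt0P[c cc] : (0 < #|five_subset_classes|)%N.
    by rewrite card_five_subset_classes.
  apply/imsetP; exists c => //; case/imsetP: cc => A; rewrite inE => /eqP cA ->.
  by rewrite orbit_five_subset_class.
move=> c cc; have card_c := card_class_stab cc; split.
  by rewrite card_c; apply/eqP; vm_compute.
have /imsetP[A] := cc; rewrite inE => /eqP cA def_c.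
have [h [[k hK kK] hA]] := frame_exists cA.
rewrite isog_sym; apply/isogP; exists (actperm_morphism (frame_action hK kK)).
  exact: injm_frame_action.
apply/eqP; rewrite eqEcard card_c card_injm ?injm_frame_action // card_wreath leqnn.
by rewrite andbT def_c; apply: frame_action_sub_stab.
Qed.
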